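(* Let $p$ be a prime and let $G$ be $\mathrm{SL}(2,q)$ or $\mathrm{PSL}(2,q)$ with $q$ a prime power. Then $G$ has a redundant Sylow $p$-subgroup if and only if $p=2$ and $q$ is not of any of the forms $2^k-1$, $2^k$, $2^k+1$ for an integer $k$.
   Context: For a finite group $G$ and a prime $p$, $G_p$ denotes the set of $p$-elements of $G$ and $\mathrm{Syl}_p(G)$ the set of Sylow $p$-subgroups of $G$. $G$ is said to have a redundant Sylow $p$-subgroup if $G_p$ is contained in the union of the members of some proper subset of $\mathrm{Syl}_p(G)$. *)

(* Defs.v *)
From HB Require Import structures.
From mathcomp Require Import all_boot all_algebra all_fingroup all_solvable.
Set Implicit Arguments. Unset Strict Implicit. Unset Printing Implicit Defensive.
Import GRing.Theory.
Local Open Scope group_scope.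

Definition p_elements (gT : finGroupType) (p : nat) (G : {set gT}) : {set gT} :=
  [set x in G | p.-elt x].

Definition has_redundant_Sylow (gT : finGroupType) (p : nat) (G : {set gT}) : Prop :=
  exists2 S : {set {group gT}}, S \proper 'Syl_p(G) &
    p_elements p G \subset \bigcup_(P in S) (P : {set gT}).

Definition SL2_set (F : finFieldType) : {set {'GL_2[F]}} :=
  [set g : {'GL_2[F]} | (\det (GLval g) == 1)%R].

Lemma SL2_group_set (F : finFieldType) : group_set (SL2_set F).
Proof.
apply/group_setP; split; first by rewrite inE GL_1E det1.
move=> x y; rewrite !inE GL_ME => /eqP dx /eqP dy.
by rewrite det_mulmx dx dy mul1r.
Qed.

Canonical SL2 (F : finFieldType) : {group {'GL_2[F]}} := Group (SL2_group_set F).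

Definition PSL2 (F : finFieldType) := (SL2 F / 'Z(SL2 F))%G.

(* Main.v *)
Require Import Defs.
From HB Require Import structures.
From mathcomp Require Import all_boot all_algebra all_fingroup all_solvable.
From mathcomp Require Import all_field ring zify.
Set Implicit Arguments. Unset Strict Implicit. Unset Printing Implicit Defensive.
Import GRing.Theory.

(** By conjugacy of Sylow subgroups, [G] has a redundant Sylow [p]-subgroup iff
    no [p]-element lies in exactly one Sylow [p]-subgroup. This is unaffected by
    factoring out a central subgroup, so only [G = SL(2,q)] matters.

    A matrix commuting with a non-scalar 2x2 matrix [x] has the form [a + b x],
    so centralisers of noncentral elements of [G] are abelian. If the only
    central [p]-element is [1], i.e. if [p] is odd or [q] is even, then every
    Sylow subgroup through [x <> 1] has a noncentral central element, hence lies
    in the abelian group [C_G(x)], so it is unique.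

    Let [p = 2] and [q] be odd, and let [N] be the one of [q - 1], [q + 1]
    divisible by 4, so that [|G|_2 = 2 N_2]. For every noncentral 2-element [x],
    [C_G(x)] is cyclic of order [N]: if [l] is an eigenvalue of [x], then
    [a + b x |-> a + b l] embeds it in the multiplicative group of a field,
    [l ^ q] is [l] or [l^-1] so its order divides [q - 1] or [q + 1], and
    counting the pairs [(a, b)] with [det (a + b x) <> 0] bounds it below by
    [q - 1]. If [N] is a power of 2, a generator of [C_G(x)] has index 2 in every
    Sylow subgroup containing it, and its normaliser is a 2-group, so that Sylow
    subgroup is unique. Otherwise [C_G(x)] has a nontrivial odd part, which
    would centralise a Sylow subgroup that is the only one containing [x]. *)

(** * Elements lying in exactly one Sylow subgroup *)

Section SoleSylow.
Local Open Scope group_scope.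
Variables (gT : finGroupType) (p : nat).
Implicit Types (G P Z : {group gT}) (x : gT).

Definition in_sole_Sylow (G : {set gT}) x : Prop :=
  exists2 P : {group gT}, p.-Sylow(G) P /\ x \in P &
    forall Q : {group gT}, p.-Sylow(G) Q -> x \in Q -> Q :=: P.

(** If a covering family omits [P0 = P :^ g], then [x ^ g] lies in another Sylow subgroup [Q] as
    well, and conjugating back puts [x] in a second Sylow subgroup besides [P]. *)
Lemma sole_Sylow_not_redundant G x :
  in_sole_Sylow G x -> ~ has_redundant_Sylow p G.
Proof.
case=> P [sylP Px] uniqP [S /properP[sSSyl [P0 sylP0 nSP0]] /subsetP covS].
have sP0 : p.-Sylow(G) P0 by rewrite inE in sylP0.
have [g Gg defP0] := Sylow_trans sylP sP0.
have P0xg : x ^ g \in P0 by rewrite defP0 memJ_conjg.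
have pxg : p.-elt (x ^ g) by apply: mem_p_elt P0xg; apply: pHall_pgroup sP0.
have Gxg : x ^ g \in G by apply: subsetP P0xg; apply: pHall_sub sP0.
have /bigcupP[Q SQ Qxg] : x ^ g \in \bigcup_(Q in S) (Q : {set gT}).
  by apply: covS; rewrite inE Gxg.
case/negP: nSP0; suff -> : P0 = Q by [].
have sylQ : p.-Sylow(G) Q by have := subsetP sSSyl Q SQ; rewrite inE.
apply/val_inj; rewrite /= defP0 -(uniqP (Q :^ g^-1)%G) ?conjsgKV //.
  by rewrite pHallJ // groupV.
by rewrite /= mem_conjgV.
Qed.

(** For the converse, fix one Sylow subgroup [P]: if each of its elements also lies in another one,
    then removing [P] alone still leaves a cover. *)
Lemma redundant_SylowP G :
  has_redundant_Sylow p G <-> forall x, ~ in_sole_Sylow G x.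
Proof.
split=> [red x /sole_Sylow_not_redundant // | nsole].
have [P sylP] := Sylow_exists p G.
case: (boolP [exists x in P, [forall (Q : {group gT} | p.-Sylow(G) Q),
                                (x \in Q) ==> (Q == P)]]).
  case/exists_inP=> x Px /forall_inP uniqP; case: (nsole x).
  by exists P => // Q sylQ Qx; have /eqP-> := implyP (uniqP Q sylQ) Qx.
rewrite negb_exists_in => /forall_inP other.
exists ('Syl_p(G) :\ P); first by rewrite properD1 // inE.
apply/subsetP=> x; rewrite inE => /andP[Gx p_x].
have [] := @Sylow_superset p _ G <[x]>; rewrite ?cycle_subG // => Q sylQ.
rewrite cycle_subG => Qx; have [eqQP | neqQP] := eqVneq Q P; last first.
  by apply/bigcupP; exists Q; rewrite // !inE neqQP.
rewrite eqQP in Qx; have := other x Qx.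
rewrite negb_forall_in => /exists_inP[R sylR].
by rewrite negb_imply => /andP[Rx nRP]; apply/bigcupP; exists R; rewrite // !inE nRP.
Qed.

(** The preimage of [P / Z] is [Z * P]. There [P] is a normal Sylow subgroup, since [Z] centralises
    it, so it contains every [p]-element. *)
Lemma mem_central_quotient_Sylow G Z P x :
    Z \subset 'Z(G) -> p.-Sylow(G) P -> x \in G -> p.-elt x ->
  (coset Z x \in P / Z) = (x \in P).
Proof.
rewrite subsetI => /andP[sZG cGZ] sylP Gx p_x.
have [sPG pP _] := and3P sylP.
have nZG : G \subset 'N(Z) by apply: cents_norm; rewrite centsC.
have nZP := subset_trans sPG nZG.
have cPZ : P \subset 'C(Z) by apply: subset_trans sPG _; rewrite centsC.
apply/idP/idP=> [|Px]; last exact: mem_quotient.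
move=> PZx; have {}PZx : x \in Z * P.
  by rewrite -quotientK // mem_morphpre ?(subsetP nZG).
rewrite -normC // -norm_joinEl // in PZx.
have sylPZ : p.-Sylow(P <*> Z) P.
  by apply: pHall_subl sylP; rewrite ?joing_subl // join_subG sPG.
rewrite (mem_normal_Hall sylPZ) // /normal joing_subl join_subG normG /=.
by rewrite cents_norm // centsC.
Qed.

End SoleSylow.

(** * Sylow subgroups of a central quotient *)

Section CentralQuotient.
Local Open Scope group_scope.
Variables (gT : finGroupType) (p : nat) (G Z : {group gT}).
Hypothesis sZZG : Z \subset 'Z(G).

Let nZG : G \subset 'N(Z).
Proof.
by move: sZZG; rewrite subsetI => /andP[_ cGZ]; apply: cents_norm; rewrite centsC.
Qed.

Lemma central_quotient_Sylow_inj (P Q : {group gT}) :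
  p.-Sylow(G) P -> p.-Sylow(G) Q -> P / Z = Q / Z -> P :=: Q.
Proof.
suff sPQ : forall P Q : {group gT}, p.-Sylow(G) P -> p.-Sylow(G) Q ->
    P / Z = Q / Z -> P \subset Q.
  by move=> sP sQ eqPQ; apply/eqP; rewrite eqEsubset !sPQ.
move=> {}P {}Q sylP sylQ eqPQ; have [sPG pP _] := and3P sylP.
apply/subsetP=> x Px; rewrite -(mem_central_quotient_Sylow sZZG sylQ).
- by rewrite -eqPQ mem_quotient.
- exact: subsetP Px.
exact: mem_p_elt Px.
Qed.

Lemma lift_central_quotient_Sylow (R : {group coset_of Z}) :
  p.-Sylow(G / Z) R -> exists2 P : {group gT}, p.-Sylow(G) P & R :=: P / Z.
Proof.
move=> sylR; have [P sylP] := Sylow_exists p G.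
have nZP := subset_trans (pHall_sub sylP) nZG.
have [u /morphimP[g Ng Gg ->] ->] := Sylow_trans (quotient_pHall nZP sylP) sylR.
by exists (P :^ g)%G; rewrite ?pHallJ //= quotientJ.
Qed.

(** The map [P |-> P / Z] is a bijection between the Sylow subgroups of [G] and of [G / Z] which
    preserves and reflects membership of [p]-elements, so lying in a sole Sylow subgroup transfers
    both ways. *)
Lemma redundant_Sylow_central_quotient :
  has_redundant_Sylow p (G / Z) <-> has_redundant_Sylow p G.
Proof.
split=> /redundant_SylowP nsole; apply/redundant_SylowP=> x [P [sylP Px] uniqP].
  have [sPG pP _] := and3P sylP.
  have [Gx p_x] := (subsetP sPG x Px, mem_p_elt pP Px).
  have nZP := subset_trans sPG nZG.
  case: (nsole (coset Z x)); exists (P / Z)%G.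
    by rewrite (quotient_pHall nZP sylP) mem_quotient.
  move=> R /lift_central_quotient_Sylow[Q sylQ defR].
  by rewrite defR (mem_central_quotient_Sylow sZZG sylQ) // => Qx; rewrite /= (uniqP Q).
have [Q sylQ defP] := lift_central_quotient_Sylow sylP.
have [sQG pQ _] := and3P sylQ.
move: Px; rewrite defP => /morphimP[y _ Qy defx]; rewrite /= in defx.
case: (nsole y); exists Q => // R sylR Ry.
have nZR := subset_trans (pHall_sub sylR) nZG.
apply: central_quotient_Sylow_inj => //; rewrite -defP.
by apply: (uniqP (R / Z)%G); rewrite ?(quotient_pHall nZR) // defx mem_quotient.
Qed.

End CentralQuotient.

(** * Groups whose noncentral elements have abelian centralisers *)

Section AbelianCentralizers.
Local Open Scope group_scope.
Variables (gT : finGroupType) (G : {group gT}).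
Hypothesis cent1_abelian : {in G :\: 'Z(G), forall y, abelian 'C_G[y]}.

(** [x] itself belongs to the abelian group ['C_G[y]]; this makes commuting transitive through
    noncentral elements. *)
Lemma noncentral_cent1_sub x y :
  x \in G -> y \in G :\: 'Z(G) -> x \in 'C[y] -> 'C_G[y] \subset 'C_G[x].
Proof.
move=> Gx Zy cxy; rewrite subsetI subsetIl sub_cent1.
by apply: subsetP (cent1_abelian Zy) _ _; rewrite inE Gx.
Qed.

Lemma abelian_cent1_not_redundant (p : nat) :
    {in 'Z(G), forall z, p.-elt z -> z = 1} -> ~ has_redundant_Sylow p G.
Proof.
move=> regZ; have [P sylP] := Sylow_exists p G.
have cardP (Q : {group gT}) : p.-Sylow(G) Q -> #|Q| = #|P|.
  by move=> sylQ; rewrite (card_Hall sylQ) (card_Hall sylP).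
(* With trivial Sylow subgroups the identity is the witness; otherwise any nontrivial [x] in [P]
   is. *)
have [P1 | /trivgPn[x Px ntx]] := eqVneq (P : {set gT}) 1.
  apply: (@sole_Sylow_not_redundant _ p G 1); exists P => // Q sylQ _.
  by apply/eqP; rewrite P1 trivg_card1 (@cardP Q) // P1 cards1.
have GZ y (Q : {group gT}) : p.-Sylow(G) Q -> y \in Q -> y != 1 -> y \in G :\: 'Z(G).
  move=> sylQ Qy nty; have [sQG pQ _] := and3P sylQ.
  rewrite inE (subsetP sQG) // andbT; apply: contra nty => Zy.
  by rewrite (regZ y) // (mem_p_elt pQ).
(* A Sylow subgroup through [x] is recovered from [x] alone. A nontrivial [z] in ['Z(Q)] is
   noncentral in [G], so [Q] lies in ['C_G[z]], which lies in ['C_G[x]]. *)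
have cQx (Q : {group gT}) : p.-Sylow(G) Q -> x \in Q -> Q :=: 'O_p('C_G[x]).
  move=> sylQ Qx; have [sQG pQ _] := and3P sylQ.
  have ntZQ : 'Z(Q) != 1.
    by rewrite (center_nil_eq1 (pgroup_nil pQ)); apply/trivgPn; exists x.
  have /trivgPn[z /setIP[Qz cQz] ntz] := ntZQ.
  have cxz : x \in 'C[z] by apply: subsetP Qx; rewrite sub_cent1.
  have sQCx : Q \subset 'C_G[x].
    have sCzx := noncentral_cent1_sub (subsetP sQG x Qx) (GZ z Q sylQ Qz ntz) cxz.
    apply: subset_trans sCzx.
    by rewrite subsetI sQG sub_cent1.
  have sylQC : p.-Sylow('C_G[x]) Q by apply: pHall_subl sylQ => //; apply: subsetIl.
  rewrite (normal_Hall_pcore sylQC) // -sub_abelian_normal //.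
  exact: cent1_abelian (GZ x Q sylQ Qx ntx).
apply: (@sole_Sylow_not_redundant _ p G x); exists P => // Q sylQ Qx.
by rewrite (cQx Q) // (cQx P).
Qed.

(** The quotient by the centraliser embeds in the automorphism group of a cyclic group of order
    [2 ^ k], whose order is again a power of 2; this is special to the prime 2. *)
Lemma pgroup2_norm_cycle x :
  2.-elt x -> 2.-group 'C_G[x] -> 2.-group 'N_G(<[x]>).
Proof.
move=> p_x pC; rewrite /pgroup -(LagrangeI 'N_G(<[x]>) 'C(<[x]>)) pnatM.
have -> : 'N_G(<[x]>) :&: 'C(<[x]>) = 'C_G[x].
  by rewrite -setIA (setIidPr (cent_sub _)) cent_cycle.
apply/andP; split=> //.
have /setIidPr sub : 'N_G(<[x]>) \subset 'N(<[x]>) by apply: subsetIr.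
have <- : #|conj_aut <[x]> @* 'N_G(<[x]>)| = #|'N_G(<[x]>) : 'C(<[x]>)|.
  by rewrite card_morphim ker_conj_aut sub.
apply: pnat_dvd (cardSg (Aut_conj_aut _ _)) _; rewrite card_Aut_cycle.
have [k ->] := p_natP p_x; case: k => [|k]; first by rewrite expn0.
by rewrite totient_pfactor // mul1n pnatX.
Qed.

(** [<[x]>] has index 2 in any Sylow subgroup containing [x], hence is normal there; so that Sylow
    subgroup is the 2-group ['N_G(<[x]>)]. *)
Lemma maximal_cycle_sole_Sylow x :
    x \in G -> 2.-elt x -> 2.-group 'C_G[x] -> (#|G|`_2 = 2 * #[x])%N ->
  in_sole_Sylow 2 G x.
Proof.
move=> Gx p_x pC oG.
have sylE (Q : {group gT}) : 2.-Sylow(G) Q -> x \in Q -> Q :=: 'N_G(<[x]>).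
  move=> sylQ Qx; have [sQG pQ _] := and3P sylQ.
  have nxQ : <[x]> <| Q.
    apply: index2_normal; rewrite ?cycle_subG //.
    by rewrite -divgS ?cycle_subG // (card_Hall sylQ) oG mulnK // order_gt0.
  apply/eqP; rewrite -(sub_pHall sylQ (pgroup2_norm_cycle p_x pC)) ?subsetIl //.
  by rewrite subsetI sQG normal_norm.
have [] := @Sylow_superset 2 _ G <[x]>; rewrite ?cycle_subG // => P sylP.
by rewrite cycle_subG => Px; exists P => // Q sylQ Qx; rewrite (sylE Q) // (sylE P).
Qed.

(* Let [C = 'C_G[x]]. Its [2']-part, generated by [o], normalises the only Sylow
   subgroup [P] through [x], while [P] normalises [<[o]>] because it normalises
   the index-2 subgroup generated by the [2]-part of [C]; hence [P] centralises
   [o], which forces [P] into [C], although [#|P|] is twice the [2]-part of [C]. *)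
Lemma nontrivial_odd_cent1_not_sole x :
    {in 'Z(G), forall z, 2^'.-elt z -> z = 1} ->
    x \in G :\: 'Z(G) -> 2.-elt x -> cyclic 'C_G[x] -> ~~ 2.-group 'C_G[x] ->
    (#|G|`_2 = 2 * #|'C_G[x]|`_2)%N ->
  ~ in_sole_Sylow 2 G x.
Proof.
move=> regZ GZx p_x cycC npC oG [P [sylP Px] uniqP].
have [Gx _] := setDP GZx; have [sPG pP _] := and3P sylP.
have [g defC] := cyclicP cycC.
pose c := g.`_2; pose o := g.`_2^'.
have Cg : g \in 'C_G[x] by rewrite defC cycle_id.
have [Cc Co] : c \in 'C_G[x] /\ o \in 'C_G[x] by rewrite defC !cycle_constt.
have [[Gc cxc] [Go cxo]] := (setIP Cc, setIP Co).
have xc : x \in <[c]>.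
  have : x \in 'C_G[x] by rewrite inE Gx cent1id.
  rewrite defC => /cycleP[k defx].
  by rewrite -(constt_p_elt p_x) defx consttX mem_cycle.
have Pc : c \in P.
  have [] := @Sylow_superset 2 _ G <[c]>; rewrite ?cycle_subG //.
    exact: p_elt_constt.
  move=> Q sylQ; rewrite cycle_subG => Qc; rewrite -(uniqP Q) //.
  by apply: subsetP xc; rewrite cycle_subG.
have nPo : o \in 'N(P).
  rewrite inE; have -> // : P :^ o = P.
  apply: (uniqP (P :^ o)%G); first by rewrite pHallJ.
  by rewrite mem_conjg conjgE invgK mulgA (cent1P cxo) mulgK.
have nPc : P \subset 'N(<[c]>).
  apply: normal_norm; apply: index2_normal; rewrite ?cycle_subG //.
  rewrite -divgS ?cycle_subG // (card_Hall sylP) oG defC.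
  by rewrite -[#|<[c]>|]/#[c] order_constt mulnK // part_gt0.
have sCcx : 'C_G(<[c]>) = 'C_G[x].
  apply/eqP; rewrite eqEsubset {2}cent_cycle noncentral_cent1_sub // andbT.
  by apply: setIS; rewrite sub_cent1; apply: subsetP xc; rewrite centsC.
have nPoo : P \subset 'N(<[o]>).
  apply: (@char_norm_trans _ _ 'C_G[x]%G); first by rewrite sub_cyclic_char // cycle_subG.
  by rewrite /= -sCcx normsI ?norms_cent // (subset_trans sPG) // normG.
have cPo : P \subset 'C(<[o]>).
  apply/commG1P/trivgP; rewrite -(@coprime_TIg _ P <[o]>).
    by rewrite commg_subI // subsetI ?subxx ?nPoo // ?cycle_subG ?nPo ?cycle_id.
  exact: pnat_coprime pP (p_elt_constt _ _).
have nto : o != 1.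
  apply: contra npC => /eqP o1; rewrite defC -[2.-group _]/(2.-elt g).
  by rewrite -(consttC 2 g) -/o o1 mulg1 p_elt_constt.
have GZo : o \in G :\: 'Z(G).
  rewrite inE Go andbT; apply: contra nto => Zo.
  by rewrite (regZ o) // p_elt_constt.
have sPC : P \subset 'C_G[x].
  apply: subset_trans (noncentral_cent1_sub Gx GZo _); last by rewrite cent1C.
  by rewrite subsetI sPG -cent_cycle.
have := dvdn_leq (part_gt0 2 _) (partn_dvd 2 (cardG_gt0 _) (cardSg sPC)).
rewrite (part_pnat_id pP) (card_Hall sylP) oG.
by rewrite leqNgt ltn_Pmull ?part_gt0.
Qed.

(** The bound on [#|'Z(G)|] gives every Sylow 2-subgroup a noncentral element, to which the
    hypothesis on centralisers applies. *)
Lemma cyclic_cent1_redundant_Sylow2 N :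
    {in 'Z(G), forall z, 2^'.-elt z -> z = 1} -> (#|'Z(G)| < #|G|`_2)%N ->
    (#|G|`_2 = 2 * N`_2)%N ->
    {in G :\: 'Z(G), forall x, 2.-elt x -> cyclic 'C_G[x] /\ #|'C_G[x]| = N} ->
  has_redundant_Sylow 2 G <-> ~~ 2.-nat N.
Proof.
move=> regZ ltZ oG cycC; have [P0 sylP0] := Sylow_exists 2 G.
have ncP (P : {group gT}) : 2.-Sylow(G) P -> exists2 x, x \in P & x \in G :\: 'Z(G).
  move=> sylP; have [sPG pP _] := and3P sylP.
  have /subsetPn[x Px nZx] : ~~ (P \subset 'Z(G)).
    by apply: contraL ltZ => /subset_leq_card; rewrite -leqNgt (card_Hall sylP).
  by exists x; rewrite // inE nZx (subsetP sPG).
split=> [red | npN].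
  apply/negP=> pN; have [x0 P0x0 GZx0] := ncP P0 sylP0.
  have [sP0G pP0 _] := and3P sylP0.
  have [cyc oC] := cycC x0 GZx0 (mem_p_elt pP0 P0x0).
  have [x defC] := cyclicP cyc; have Cx : x \in 'C_G[x0] by rewrite defC cycle_id.
  have [Gx cx0x] := setIP Cx.
  have ox : #[x] = N by rewrite -oC defC.
  have p_x : 2.-elt x by rewrite /p_elt ox.
  apply: (sole_Sylow_not_redundant _ red); apply: (maximal_cycle_sole_Sylow Gx p_x).
    (* [x0] is a power of the generator [x], so ['C_G[x]] lies in ['C_G[x0]], whose order [N] is a
       power of 2. *)
    rewrite /pgroup; apply: pnat_dvd pN; rewrite -oC cardSg // subsetI subsetIl.
    have : x0 \in 'C_G[x0] by rewrite inE cent1id (setDP GZx0).1.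
    rewrite defC => /cycleP[k ->]; apply: subset_trans (subsetIr G _) _.
    by apply/subsetP=> y /cent1P cyx; apply/cent1P; apply: commuteX.
  by rewrite oG ox part_pnat_id.
apply/redundant_SylowP=> x [P [sylP Px] uniqP]; have [sPG pP _] := and3P sylP.
have [y [Py GZy uniqy]] : exists y, [/\ y \in P, y \in G :\: 'Z(G) &
    forall Q : {group gT}, 2.-Sylow(G) Q -> y \in Q -> Q :=: P].
  (* A central 2-element lies in every Sylow 2-subgroup; then [P] is the only one, and any of its
     noncentral elements can replace [x]. *)
  have [Zx | nZx] := boolP (x \in 'Z(G)); last first.
    by exists x; rewrite // inE nZx (subsetP sPG).
  have [y Py GZy] := ncP P sylP; exists y; split=> // Q sylQ _; apply: uniqP => //.
  rewrite -cycle_subG; apply: subset_trans (pcore_sub_Hall sylQ).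
  rewrite pcore_max //; first exact: mem_p_elt pP Px.
  by rewrite sub_center_normal // cycle_subG.
have [cyc oC] := cycC y GZy (mem_p_elt pP Py).
apply: (nontrivial_odd_cent1_not_sole regZ GZy (mem_p_elt pP Py) cyc).
- by rewrite /pgroup oC.
- by rewrite oC.
by exists P.
Qed.

End AbelianCentralizers.

(** * Two-by-two matrices over a field *)

Section Matrix2.
Local Open Scope ring_scope.
Variable F : fieldType.
Implicit Types A B : 'M[F]_2.

Lemma matrix2P A B : A 0 0 = B 0 0 -> A 0 1 = B 0 1 -> A 1 0 = B 1 0 ->
  A 1 1 = B 1 1 -> A = B.
Proof.
move=> e00 e01 e10 e11; apply/matrixP=> i j.
have ord2 (k : 'I_2) : k = 0 \/ k = 1.
  by case: k => [[|[|k]] lt_k2] //; [left | right]; apply: val_inj.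
by case: (ord2 i) (ord2 j) => -> [] ->.
Qed.

Lemma mulmx2E A B i j : (A *m B) i j = A i 0 * B 0 j + A i 1 * B 1 j.
Proof.
rewrite mxE !big_ord_recl big_ord0 addr0; congr (_ * _ + A i _ * B _ j).
all: exact: val_inj.
Qed.

Lemma mxtrace2 A : \tr A = A 0 0 + A 1 1.
Proof.
rewrite /mxtrace !big_ord_recl big_ord0 addr0; congr (_ + A _ _).
all: exact: val_inj.
Qed.

Lemma det2 A : \det A = A 0 0 * A 1 1 - A 0 1 * A 1 0.
Proof.
rewrite (expand_det_row A 0) !big_ord_recl big_ord0 addr0.
rewrite /cofactor !det_mx11 !mxE /= expr0 mul1r expr1 mulN1r mulrN.
by congr (_ * A _ _ - A _ _ * A _ _); apply: val_inj.
Qed.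

Lemma det_linear2 A a b :
  \det (a%:M + b *: A) = a ^+ 2 + a * b * \tr A + b ^+ 2 * \det A.
Proof. by rewrite !det2 mxtrace2 !mxE /=; ring. Qed.

Lemma Cayley_Hamilton2 A : A *m A = \tr A *: A - (\det A)%:M.
Proof.
by apply: matrix2P; rewrite mulmx2E mxtrace2 det2 !mxE /=; ring.
Qed.

(** One of [A 0 1], [A 1 0], [A 0 0 - A 1 1] is nonzero. Dividing the corresponding entry or
    difference of [B] by it gives [b], and a diagonal entry then gives [a]. *)
Lemma nonscalar_comm_mx2 A B : ~~ is_scalar_mx A -> A *m B = B *m A ->
  exists a b, B = a%:M + b *: A.
Proof.
move=> nscA /matrixP comAB.
have := comAB 0 0; have := comAB 0 1; have := comAB 1 0; rewrite !mulmx2E.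
move=> e10 e01 e00.
have {}e00 : A 0 1 * B 1 0 = B 0 1 * A 1 0.
  by apply: (addrI (A 0 0 * B 0 0)); rewrite e00; ring.
have {}e01 : A 0 1 * B 1 1 = A 0 1 * B 0 0 + B 0 1 * (A 1 1 - A 0 0).
  by apply: (addrI (A 0 0 * B 0 1)); rewrite e01; ring.
have {}e10 : A 1 0 * B 0 0 = A 1 0 * B 1 1 + B 1 0 * (A 0 0 - A 1 1).
  by apply: (addIr (A 1 1 * B 1 0)); rewrite e10; ring.
have [A01 | nzA01] := eqVneq (A 0 1) 0; last first.
  exists (B 0 0 - B 0 1 / A 0 1 * A 0 0), (B 0 1 / A 0 1).
  apply: matrix2P; rewrite !mxE /= ?mulr1n ?mulr0n ?add0r; first by ring.
  - by rewrite divfK.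
  - by apply: (mulfI nzA01); rewrite e00; field.
  by apply: (mulfI nzA01); rewrite e01; field.
have [A10 | nzA10] := eqVneq (A 1 0) 0; last first.
  exists (B 1 1 - B 1 0 / A 1 0 * A 1 1), (B 1 0 / A 1 0).
  apply: matrix2P; rewrite !mxE /= ?mulr1n ?mulr0n ?add0r; last by ring.
  - by apply: (mulfI nzA10); rewrite e10; field.
  - by apply: (mulIf nzA10); rewrite -e00; field.
  by rewrite divfK.
have nzA : A 0 0 - A 1 1 != 0.
  apply: contra nscA; rewrite subr_eq0 => /eqP A00; apply/is_scalar_mxP.
  by exists (A 0 0); apply: matrix2P; rewrite !mxE.
move/eqP: e01; rewrite A01 !mul0r add0r eq_sym -opprB mulrN oppr_eq0 mulf_eq0.
rewrite (negPf nzA) orbF => /eqP B01.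
move/eqP: e10; rewrite A10 !mul0r add0r eq_sym mulf_eq0.
rewrite (negPf nzA) orbF => /eqP B10.
exists (B 0 0 - (B 0 0 - B 1 1) / (A 0 0 - A 1 1) * A 0 0).
exists ((B 0 0 - B 1 1) / (A 0 0 - A 1 1)).
by apply: matrix2P; rewrite !mxE /= ?mulr1n ?mulr0n ?A01 ?A10 ?B01 ?B10; field.
Qed.

End Matrix2.

(** * Centre, centralisers and order of SL(2, q) *)

Section SL2Structure.
Local Open Scope ring_scope.
Variable F : finFieldType.
Local Notation G := (SL2 F).
Local Notation q := #|F|.

Lemma GLval_inj : injective (@GLval 2 F). Proof. exact: val_inj. Qed.

Lemma SL2_det (g : {'GL_2[F]}) : (g \in G) = (\det (GLval g) == 1).
Proof. by rewrite inE. Qed.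

Lemma unitmx_det_neq0 (M : 'M[F]_2) : \det M != 0 -> M \is a GRing.unit.
Proof. by move=> nzM; rewrite -[_ \is a _]/(M \in unitmx) unitmxE unitfE. Qed.

Definition GL2_of (M : 'M[F]_2) (nzM : \det M != 0) : {'GL_2[F]} :=
  FinRing.unit _ (unitmx_det_neq0 nzM).

Lemma GL2_ofE (M : 'M[F]_2) (nzM : \det M != 0) : GLval (GL2_of nzM) = M.
Proof. by []. Qed.

Lemma SL2_center_scalarP (g : {'GL_2[F]}) : g \in G ->
  reflect (exists2 a, GLval g = a%:M & a ^+ 2 = 1) (g \in 'Z(G)%g).
Proof.
move=> Gg; have /eqP dg : \det (GLval g) == 1 by rewrite -SL2_det.
apply: (iffP idP) => [/setIP[_ /centP cGg] | [a defg _]]; last first.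
  apply/setIP; split=> //; apply/centP=> h _; apply: GLval_inj.
  by rewrite !GL_MxE defg scalar_mxC.
have comm (M : 'M[F]_2) : \det M = 1 -> GLval g *m M = M *m GLval g.
  move=> dM; have nzM : \det M != 0 by rewrite dM oner_neq0.
  have GM : GL2_of nzM \in G by rewrite SL2_det GL2_ofE dM.
  by have := congr1 GLval (cGg _ GM); rewrite !GL_MxE GL2_ofE.
(* Commuting with the two unipotent matrices [u] and [u^T] already forces [g] to be scalar. *)
pose u : 'M[F]_2 := \matrix_(i < 2, j < 2) (i <= j)%:R.
have du : \det u = 1 by rewrite det2 !mxE /=; ring.
have /matrixP cu := comm u du; have /matrixP cut := comm u^T (etrans (det_tr u) du).
have := cu 0 0; have := cu 0 1; have := cut 0 0; rewrite !mulmx2E !mxE /=.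
rewrite !mulr1 !mulr0 !mul1r !mul0r ?addr0 ?add0r.
move=> /eqP; rewrite -subr_eq0 addrAC subrr add0r => /eqP g01.
move=> /eqP; rewrite g01 addr0 ?add0r => /eqP g00.
move=> /eqP; rewrite eq_sym -subr_eq0 addrAC subrr add0r => /eqP g10.
have defg : GLval g = (GLval g 0 0)%:M by apply: matrix2P; rewrite !mxE //=.
by exists (GLval g 0 0); rewrite // -dg [in RHS]defg det_scalar.
Qed.

Lemma SL2_noncentral_nonscalar (g : {'GL_2[F]}) :
  g \in (G :\: 'Z(G))%g -> ~~ is_scalar_mx (GLval g).
Proof.
case/setDP=> Gg; apply: contra => /is_scalar_mxP[a defg].
apply/(SL2_center_scalarP Gg); exists a => //.
by move: Gg; rewrite SL2_det defg det_scalar => /eqP.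
Qed.

Lemma SL2_cent1P (x y : {'GL_2[F]}) : x \in (G :\: 'Z(G))%g -> y \in 'C[x]%g ->
  exists a b, GLval y = a%:M + b *: GLval x.
Proof.
move=> GZx /cent1P/(congr1 GLval); rewrite !GL_MxE => cxy.
by apply: nonscalar_comm_mx2; rewrite ?SL2_noncentral_nonscalar.
Qed.

Lemma SL2_cent1_abelian : {in G :\: 'Z(G), forall x, abelian 'C_G[x]}%g.
Proof.
move=> x GZx; apply/centsP=> y /setIP[_ cxy] z /setIP[_ cxz].
have [[a [b defy]] [c [d defz]]] := (SL2_cent1P GZx cxy, SL2_cent1P GZx cxz).
apply: GLval_inj; rewrite !GL_MxE defy defz.
rewrite !mulmxDl !mulmxDr !mul_scalar_mx !mul_mx_scalar -!scalemxAl -!scalemxAr.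
by apply/matrixP=> i j; rewrite !mxE; ring.
Qed.

Lemma SL2_center_sqr1 (z : {'GL_2[F]}) : z \in 'Z(G)%g -> (z ^+ 2 = 1)%g.
Proof.
move=> Zz; have /setIP[Gz _] := Zz.
have [a defz a2] := SL2_center_scalarP Gz Zz.
by apply: GLval_inj; rewrite expgS expg1 GL_MxE defz -scalar_mxM -expr2 a2.
Qed.

Lemma card_SL2_center : (#|'Z(G)%g| <= 2)%N.
Proof.
pose f (g : {'GL_2[F]}) := GLval g 0 0.
have injf : {in 'Z(G)%g &, injective f}.
  move=> g h Zg Zh; have [[Gg _] [Gh _]] := (setIP Zg, setIP Zh).
  have [[a defg _] [b defh _]] := (SL2_center_scalarP Gg Zg, SL2_center_scalarP Gh Zh).
  by rewrite /f defg defh !mxE !mulr1n => eqab; apply: GLval_inj; rewrite defg eqab.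
rewrite -(card_in_imset injf); apply: (@leq_trans #|[set 1; -1 : F]|).
  apply/subset_leq_card/subsetP=> _ /imsetP[g Zg ->]; have [Gg _] := setIP Zg.
  have [a defg /eqP] := SL2_center_scalarP Gg Zg.
  by rewrite sqrf_eq1 /f defg !mxE !inE.
by rewrite cards2 ltnS leq_b1.
Qed.

Lemma GL2_det_unit (g : {'GL_2[F]}) : \det (GLval g) \is a GRing.unit.
Proof. by rewrite unitfE GL_det. Qed.

Definition GL2_det (g : {'GL_2[F]}) : {unit F} := FinRing.unit F (GL2_det_unit g).

Lemma GL2_det_is_morph :
  {in [set: {'GL_2[F]}] &, {morph GL2_det : g h / (g * h)%g}}.
Proof. by move=> g h _ _; apply: val_inj; rewrite /= -det_mulmx. Qed.

Canonical GL2_det_morphism := Morphism GL2_det_is_morph.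

Lemma ker_GL2_det : ('ker GL2_det = G)%g.
Proof.
apply/setP=> g; rewrite SL2_det !inE /= -(inj_eq val_inj) /=.
by [].
Qed.

Lemma card_SL2 : #|G| = (q * q.-1 * q.+1)%N.
Proof.
have := card_morphim GL2_det_morphism [group of [set: {'GL_2[F]}]]%g.
rewrite /= setIid ker_GL2_det.
have -> : (GL2_det @* [set: {'GL_2[F]}] = [set: {unit F}])%g.
  apply/setP=> u; rewrite inE; apply/morphimP.
  (* The diagonal matrix with entries [u] and 1 shows that the determinant is onto. *)
  pose M : 'M[F]_2 := \matrix_(i, j) (if i == j then if i == 0 then val u else 1 else 0).
  have dM : \det M = val u by rewrite det2 !mxE /=; ring.
  have nzM : \det M != 0 by rewrite dM -unitfE (valP u).
  by exists (GL2_of nzM); rewrite ?inE //; apply: val_inj; rewrite /= dM.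
rewrite card_finField_unit => oq.
have := Lagrange (subsetT G); rewrite -oq -[#|[set: _]|]/#|'GL_2[F]%g| card_GL_2 => oG.
have q1_gt0 : (0 < q.-1)%N by case: #|F| (finNzRing_gt1 F) => [|[]].
apply/eqP; rewrite -(eqn_pmul2r q1_gt0) oG.
by apply/eqP; rewrite (mulnAC _ q.+1) expnS expn1 !mulnA.
Qed.

Lemma GLvalX (g : {'GL_2[F]}) k : GLval (g ^+ k)%g = GLval g ^+ k.
Proof. by elim: k => [|k IHk] //; rewrite expgS exprS GL_ME IHk. Qed.

Lemma char_root_exists (M : 'M[F]_2) : exists (L : fieldExtType F) (l : L) (v : 'rV[L]_2),
  v *m map_mx (in_alg L) M = l *: v /\ v != 0.
Proof.
have nz_p : char_poly M != 0 by rewrite monic_neq0 ?char_poly_monic.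
have [L [rs eq_p _]] := FinSplittingFieldFor nz_p.
exists L; case: rs eq_p => [|l rs] eq_p.
  have := eqp_size eq_p; rewrite big_nil size_poly1 size_map_poly size_char_poly.
  by [].
have : root (char_poly (map_mx (in_alg L) M)) l.
  by rewrite -map_char_poly (eqp_root eq_p) root_prod_XsubC mem_head.
by rewrite -eigenvalue_root_char => /eigenvalueP[v vM nzv]; exists l, v.
Qed.

End SL2Structure.

(** A proper divisor of [n.+1] is at most half of it, which is below [n.-1] except when [n = 3];
    there it would be at most 2, contradicting [4 %| c]. *)
Lemma dvdn_predn_or_succn c n : odd n -> 1 < n -> 4 %| c -> n.-1 <= c ->
  (c %| n.-1) || (c %| n.+1) -> c = n.-1 \/ c = n.+1.
Proof.
move=> odd_n n_gt1 /dvdnP[j defc] le_c /orP[] c_dvd; [left | right].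
  have n1_gt0 : 0 < n.-1 by lia.
  by apply/eqP; rewrite eqn_leq le_c (dvdn_leq n1_gt0 c_dvd).
have [[|[|k]] defn] := dvdnP c_dvd; [by [] | lia |].
have := leq_mul (isT : 2 <= k.+2) (leqnn c); lia.
Qed.

(** * Eigenvalues, and the orders of centralisers *)

Section SL2Torus.
Local Open Scope ring_scope.
Variable F : finFieldType.
Local Notation G := (SL2 F).
Local Notation q := #|F|.

Lemma unipotent2_exp (N : 'M[F]_2) k : N * N = 0 -> (1 + N) ^+ k = 1 + N *+ k.
Proof.
move=> N2; elim: k => [|k IHk]; first by rewrite mulr0n addr0.
rewrite exprS IHk mulrDl mul1r mulrDr mulr1 mulrnAr N2 mul0rn addr0.
by rewrite mulrS [N + _]addrC addrA.
Qed.

(** If the squared trace is 4, then [N = t X - 2] has square zero and [X ^+ 2 = 1 + N]. Raising to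
    the order of [x], which is invertible in [F], forces [N = 0], so [X] would be scalar. Using
    [X ^+ 2] avoids distinguishing the double eigenvalues 1 and -1. *)
Lemma SL2_trace_semisimple (x : {'GL_2[F]}) :
    x \in (G :\: 'Z(G))%g -> #[x]%g%:R != 0 :> F -> 2%:R != 0 :> F ->
  \tr (GLval x) ^+ 2 != 4%:R.
Proof.
move=> GZx nz_ox nz2; have [Gx _] := setDP GZx.
have dx : \det (GLval x) = 1 by apply/eqP; rewrite -SL2_det.
apply/eqP; set t := \tr _ => t2; set X : 'M[F]_2 := GLval x.
have X2 : X * X = t *: X - 1%:M by have := Cayley_Hamilton2 X; rewrite dx.
pose N : 'M[F]_2 := (- 2%:R)%:M + t *: X.
have N2 : N * N = 0.
  have trN : \tr N = 0.
    by rewrite mxtraceD mxtrace_scalar mxtraceZ -expr2 t2; ring.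
  have dN : \det N = 0 by rewrite det_linear2 dx -/t mulrAC -mulrA -expr2 t2; ring.
  by have := Cayley_Hamilton2 N; rewrite trN dN scale0r raddf0 subr0.
have X2N : X ^+ 2 = 1 + N.
  have -> : 1 = 1%:M :> 'M[F]_2 by [].
  rewrite expr2 X2; apply/matrixP=> i j; rewrite !mxE.
  by case: (i == j); rewrite ?mulr1n ?mulr0n; ring.
have N0 : N = 0.
  have /eqP := unipotent2_exp #[x]%g N2.
  rewrite -X2N exprAC -GLvalX expg_order GL_1E expr1n.
  rewrite -subr_eq0 opprD addrA subrr add0r oppr_eq0 -scaler_nat scaler_eq0.
  by rewrite (negPf nz_ox) => /eqP.
have nzt : t != 0 by rewrite -sqrf_eq0 t2 (natrM _ 2 2) mulf_neq0.
have := SL2_noncentral_nonscalar GZx; case/negP; apply/is_scalar_mxP.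
exists (t^-1 * 2%:R); apply: (scalerI nzt); rewrite scale_scalar_mx mulVKf //.
by apply/eqP; rewrite -subr_eq0 addrC -raddfN -N0.
Qed.

Section Eigenvalue.
Variables (x : {'GL_2[F]}) (L : fieldExtType F) (l : L) (v : 'rV[L]_2).
Hypotheses (GZx : x \in (G :\: 'Z(G))%g).
Hypotheses (vx : v *m map_mx (in_alg L) (GLval x) = l *: v) (nzv : v != 0).
Local Notation iota := (in_alg L).
Local Notation t := (\tr (GLval x)).

Let Gx : x \in G. Proof. by case/setDP: GZx. Qed.
Let dx : \det (GLval x) = 1. Proof. by apply/eqP; rewrite -SL2_det. Qed.

Lemma eigenvalue_quadratic : l ^+ 2 = iota t * l - 1.
Proof.
have := congr1 (fun M => v *m map_mx iota M) (Cayley_Hamilton2 (GLval x)).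
rewrite dx map_mxM mulmxA vx -scalemxAl vx scalerA -expr2.
rewrite map_mxB map_mxZ map_scalar_mx mulmxBr -scalemxAr vx scalerA rmorph1 mulmx1.
rewrite -[X in _ = _ - X]scale1r -scalerBl => /eqP; rewrite -subr_eq0 -scalerBl.
by rewrite scaler_eq0 (negPf nzv) orbF subr_eq0 => /eqP.
Qed.

Let nzl : l != 0.
Proof.
apply/eqP=> l0; have /eqP := eigenvalue_quadratic.
by rewrite l0 expr0n mulr0 add0r eq_sym oppr_eq0 oner_eq0.
Qed.

Lemma eigenvalue_trace : iota t = l + l^-1.
Proof.
apply: (mulIf nzl); rewrite mulrDl mulVf // -expr2 eigenvalue_quadratic; ring.
Qed.

Lemma eigenvalue_sqr_neq1 : t ^+ 2 != 4%:R -> l ^+ 2 != 1.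
Proof.
apply: contra => /eqP l2; rewrite -(inj_eq (fmorph_inj iota)) rmorphXn /=.
rewrite -!in_algE eigenvalue_trace rmorph_nat.
have -> : l^-1 = l by apply: (mulfI nzl); rewrite divff // -expr2 l2.
by apply/eqP; rewrite -mulr2n exprMn_n l2.
Qed.

Lemma det_eigenvalue a b :
  iota (\det (a%:M + b *: GLval x)) = (iota a + iota b * l) * (iota a + iota b * l^-1).
Proof.
rewrite det_linear2 dx mulr1 !rmorphD !rmorphM /= -!in_algE eigenvalue_trace.
by field.
Qed.

(** Since [q] is a power of the characteristic of [L], the [q]-th power map is additive on [L]. *)
Let pchar_q : [pchar L].-nat q.
Proof.
have [p pr_p charFp] := finPcharP F; rewrite (card_pprimeChar charFp).
by rewrite pnatX pnatE // (rmorph_pchar iota charFp).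
Qed.

Let iota_q a : iota a ^+ q = iota a.
Proof. by rewrite -rmorphXn expf_card. Qed.

(** The [q]-th power map fixes the coefficients of the quadratic equation of [l], so it permutes the
    roots [l] and [l^-1]. *)
Lemma eigenvalue_Frobenius : (l ^+ q == l) || (l ^+ q == l^-1).
Proof.
have lq : (l ^+ q) ^+ 2 = iota t * l ^+ q - 1.
  rewrite exprAC; apply: (addIr 1); rewrite subrK -[X in _ + X](expr1n L q).
  by rewrite -exprDn_pchar // eigenvalue_quadratic subrK exprMn iota_q.
rewrite -subr_eq0 -[X in _ || X]subr_eq0 -mulf_eq0 mulrBl !mulrBr divff //.
rewrite -expr2 lq eigenvalue_trace; apply/eqP; ring.
Qed.

(** Over [L] the determinant is a product of two linear forms. Each vanishes on at most [q] pairs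
    and both vanish at [(0, 0)], so at most [2q - 1] of the [q ^ 2] pairs are lost. *)
Lemma card_det_neq0 :
  (q.-1 ^ 2 <= #|[set ab : F * F | (\det (ab.1%:M + ab.2 *: GLval x) != 0)%R]|)%N.
Proof.
pose S := [set ab : F * F | \det (ab.1%:M + ab.2 *: GLval x) != 0].
pose Z m := [set ab : F * F | iota ab.1 + iota ab.2 * m == 0].
have cardZ m : (#|Z m| <= q)%N.
  have injZ : {in Z m &, injective (fun ab : F * F => ab.2)}.
    move=> [a b] [c d]; rewrite !inE /= => ab cd bd; congr (_, _) => //.
    apply: (fmorph_inj iota); apply: (addIr (iota b * m)).
    by rewrite (eqP ab) bd (eqP cd).
  by rewrite -(card_in_imset injZ) max_card.
have Z0 : (0 < #|Z l :&: Z l^-1|)%N.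
  by apply/card_gt0P; exists (0, 0); rewrite !inE /= !scale0r !mul0r addr0 eqxx.
have : (#|~: S| <= #|Z l :|: Z l^-1|)%N.
  apply/subset_leq_card/subsetP=> -[a b]; rewrite !inE negbK /= => /eqP ab0.
  by rewrite -mulf_eq0 -det_eigenvalue ab0 rmorph0.
have := cardsUI (Z l) (Z l^-1); have := cardsC S; rewrite card_prod.
have := cardZ l; have := cardZ l^-1; have := finNzRing_gt1 F; rewrite -/S.
move: Z0 #|~: S| #|S| #|Z l :|: _| #|Z l| #|Z l^-1| => /=.
move: #|_ :&: _| #|F| => c0 n; nia.
Qed.

(** The invertible matrices [a + b x] are distinct elements of the centraliser in GL(2, q). The
    determinant takes at most [q.-1] values on it, with kernel ['C_G[x]]. *)
Lemma leq_card_SL2_cent1 : (q.-1 <= #|'C_G[x]%g|)%N.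
Proof.
pose S := [set ab : F * F | \det (ab.1%:M + ab.2 *: GLval x) != 0].
pose e (ab : F * F) : 'M[F]_2 := ab.1%:M + ab.2 *: GLval x.
have nsc := SL2_noncentral_nonscalar GZx.
have inj_e : injective e.
  move=> [a b] [c d]; rewrite /e /= => eq_e.
  have eq_bd : b = d.
    apply/eqP; rewrite -subr_eq0; apply: contraR nsc => nz; apply/is_scalar_mxP.
    exists ((b - d)^-1 * (c - a)); apply: (scalerI nz).
    rewrite scale_scalar_mx mulVKf // raddfB scalerBl /=.
    by apply/eqP; rewrite subr_eq eq_sym addrAC subr_eq [eqbRHS]addrC eq_e.
  rewrite eq_bd in eq_e *; move/addIr/matrixP/(_ 0 0): eq_e.
  by rewrite !mxE !mulr1n => ->.
have leSC : (#|S| <= #|'C[x]%g|)%N.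
  rewrite -(card_imset _ inj_e) -(card_imset _ (@GLval_inj F)).
  apply/subset_leq_card/subsetP=> _ /imsetP[[a b] + ->]; rewrite inE /= => nz_ab.
  apply/imsetP; exists (GL2_of nz_ab); last by rewrite GL2_ofE.
  apply/cent1P; apply: GLval_inj; rewrite !GL_MxE GL2_ofE.
  by rewrite mulmxDl mulmxDr scalar_mxC -scalemxAl -scalemxAr.
have := leq_trans card_det_neq0 leSC.
rewrite -(LagrangeI 'C[x]%G G) setIC -ker_GL2_det.
have -> : (#|'C[x] : 'ker (@GL2_det F)| = #|GL2_det (F:=F) @* 'C[x]|)%g.
  by rewrite card_morphim setTI.
have := subset_leq_card (subsetT (@GL2_det F @* 'C[x])%g).
rewrite card_finField_unit ker_GL2_det.
have q1_gt0 : (0 < q.-1)%N by case: #|F| (finNzRing_gt1 F) => [|[]].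
move=> le1 le2; rewrite -(leq_pmul2r q1_gt0); rewrite expnS expn1 in le2.
by apply: leq_trans le2 _; rewrite leq_mul2l le1 orbT.
Qed.

(* The eigenvalue of [y] on [v], read off at a nonzero coordinate of [v]. *)
Definition eigen_char (y : {'GL_2[F]}) : L :=
  (v *m map_mx iota (GLval y)) 0 (if v 0 0 == 0 then 1 else 0)
    / v 0 (if v 0 0 == 0 then 1 else 0).

Lemma mul_eigenvector (y : {'GL_2[F]}) a b : GLval y = a%:M + b *: GLval x ->
  v *m map_mx iota (GLval y) = (iota a + iota b * l) *: v.
Proof.
move=> ->; rewrite map_mxD map_scalar_mx map_mxZ mulmxDr mul_mx_scalar.
by rewrite -scalemxAr vx scalerA scalerDl.
Qed.

Lemma eigen_charE (y : {'GL_2[F]}) a b : GLval y = a%:M + b *: GLval x ->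
  eigen_char y = iota a + iota b * l.
Proof.
move=> defy; rewrite /eigen_char (mul_eigenvector defy) mxE mulfK //.
case: ifPn => // /eqP v0; apply: contra nzv => /eqP v1; apply/eqP/matrixP=> i j.
rewrite ord1 mxE; have [-> // | ] := eqVneq j 0.
by case: j => [[|[|j]] lt_j2] // _; rewrite -v1; congr (v 0 _); apply: val_inj.
Qed.

Section Semisimple.
Hypothesis l2_neq1 : l ^+ 2 != 1.

Let nzlV : l - l^-1 != 0.
Proof.
apply: contra l2_neq1; rewrite subr_eq0 => /eqP lV.
by rewrite expr2 {2}lV divff.
Qed.

Lemma eigen_charM : {in 'C_G[x]%g &, {morph eigen_char : y z / (y * z)%g >-> y * z}}.
Proof.
move=> y z /setIP[_ cxy] /setIP[_ cxz].
have [[a [b defy]] [c [d defz]]] := (SL2_cent1P GZx cxy, SL2_cent1P GZx cxz).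
rewrite [eigen_char y](eigen_charE defy) [eigen_char z](eigen_charE defz).
have [e [f defyz]] := SL2_cent1P GZx (groupM cxy cxz).
rewrite (eigen_charE defyz).
have := mul_eigenvector defyz; rewrite GL_MxE map_mxM mulmxA (mul_eigenvector defy).
rewrite -scalemxAl (mul_eigenvector defz) scalerA => /eqP.
by rewrite eq_sym -subr_eq0 -scalerBl scaler_eq0 (negPf nzv) orbF subr_eq0 => /eqP.
Qed.

(** Since the determinant is 1, [a + b l = 1] forces [a + b l^-1 = 1] too; as [l] and [l^-1] differ,
    [b = 0] and [a = 1]. *)
Lemma eigen_char_eq1 : {in 'C_G[x]%g, forall y, eigen_char y = 1 <-> y = 1%g}.
Proof.
move=> y /setIP[Gy cxy]; have [a [b defy]] := SL2_cent1P GZx cxy.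
rewrite (eigen_charE defy); split=> [ab1 | y1]; last first.
  have := mul_eigenvector defy; rewrite y1 GL_1E map_mx1 mulmx1.
  rewrite -[LHS]scale1r => /eqP; rewrite eq_sym -subr_eq0 -scalerBl scaler_eq0.
  by rewrite (negPf nzv) orbF subr_eq0 => /eqP.
have := det_eigenvalue a b; rewrite -defy; move: Gy; rewrite SL2_det => /eqP->.
rewrite rmorph1 ab1 mul1r => /esym ab1V.
have b0 : b = 0.
  have /eqP : iota b * (l - l^-1) = 0.
    by rewrite mulrBr -(subrr (iota a + iota b * l)) {2}ab1 -ab1V; ring.
  by rewrite mulf_eq0 (negPf nzlV) orbF fmorph_eq0 => /eqP.
have a1 : a = 1.
  by apply: (fmorph_inj iota); rewrite rmorph1 -ab1 b0 rmorph0 mul0r addr0.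
by apply: GLval_inj; rewrite defy a1 b0 scale0r addr0.
Qed.

Lemma SL2_cent1_cyclic : cyclic 'C_G[x]%g.
Proof. exact: field_mul_group_cyclic eigen_charM eigen_char_eq1. Qed.

Lemma eigen_charX k : {in 'C_G[x]%g, forall y, eigen_char (y ^+ k)%g = eigen_char y ^+ k}.
Proof.
move=> y Cy; elim: k => [|k IHk]; first exact/(eigen_char_eq1 (group1 _)).
by rewrite expgS exprS eigen_charM ?IHk // groupX.
Qed.

(** The [q]-th power of the eigenvalue [a + b l] of a generator is [a + b l ^+ q], which is either
    that eigenvalue or [a + b l^-1], its inverse. *)
Lemma SL2_cent1_card_dvd : (#|'C_G[x]%g| %| q.-1)%N || (#|'C_G[x]%g| %| q.+1)%N.
Proof.
have [g defC] := cyclicP SL2_cent1_cyclic.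
have Cg : g \in 'C_G[x]%g by rewrite defC cycle_id.
have [Gg cxg] := setIP Cg; have [a [b defg]] := SL2_cent1P GZx cxg.
have := det_eigenvalue a b; rewrite -defg; move: (Gg); rewrite SL2_det => /eqP->.
rewrite rmorph1 => ab1.
have eg := eigen_charE defg.
have egq : eigen_char g ^+ q = iota a + iota b * l ^+ q.
  by rewrite eg exprDn_pchar // exprMn !iota_q.
have nzg : eigen_char g != 0.
  by rewrite eg; apply: contraTneq (oner_neq0 L) => ab0; rewrite ab1 ab0 mul0r eqxx.
rewrite defC -[#|_|]/#[g]%g !order_dvdn; apply/orP.
case/orP: eigenvalue_Frobenius => /eqP lq; [left | right].
  apply/eqP/(eigen_char_eq1 (groupX _ Cg)); rewrite eigen_charX //.
  apply: (mulfI nzg); rewrite -exprS prednK ?mulr1 ?egq ?lq //.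
  exact: ltnW (finNzRing_gt1 F).
by apply/eqP/(eigen_char_eq1 (groupX _ Cg)); rewrite eigen_charX // exprS egq lq eg.
Qed.

End Semisimple.
End Eigenvalue.

Lemma SL2_noncentral_2elt_cent1 (x : {'GL_2[F]}) :
    odd q -> x \in (G :\: 'Z(G))%g -> (2.-elt x)%g ->
  [/\ cyclic 'C_G[x]%g, (4 %| #|'C_G[x]%g|)%N &
      #|'C_G[x]%g| = q.-1 \/ #|'C_G[x]%g| = q.+1].
Proof.
move=> odd_q GZx p_x; have [Gx nZx] := setDP GZx.
have q_gt1 := finNzRing_gt1 F.
have nz2 : 2%:R != 0 :> F.
  apply: contraL odd_q => char2; have char2F : 2 \in [pchar F] by rewrite inE char2.
  rewrite (card_pprimeChar char2F) oddX /= orbF; apply/negP=> /eqP n0.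
  by move: q_gt1; rewrite (card_pprimeChar char2F) n0.
have [m om] := p_natP p_x.
have nz_ox : #[x]%g%:R != 0 :> F by rewrite om natrX expf_neq0.
have tr4 := SL2_trace_semisimple GZx nz_ox nz2.
have [L [l [v [vx nzv]]]] := char_root_exists (GLval x).
have l2 := eigenvalue_sqr_neq1 GZx vx nzv tr4.
have cyc := SL2_cent1_cyclic GZx vx nzv l2.
have dvd := SL2_cent1_card_dvd GZx vx nzv l2.
have le := leq_card_SL2_cent1 GZx vx nzv.
(* The eigenvalue [l ^+ 2] of [x ^+ 2] is not 1, so the 2-element [x] has order divisible by 4. *)
have x2 : (x ^+ 2 != 1)%g.
  have Cx : x \in 'C_G[x]%g by rewrite inE Gx cent1id.
  apply: (contraNN _ l2) => /eqP x2; have := eigen_charX GZx vx nzv l2 2 Cx.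
  have defx : GLval x = 0%:M + 1 *: GLval x by rewrite raddf0 add0r scale1r.
  rewrite x2 (eigen_charE vx nzv defx) rmorph0 rmorph1 mul1r add0r.
  by move=> <-; apply/eqP/(eigen_char_eq1 GZx vx nzv l2 (group1 _)).
have dvd4 : (4 %| #|'C_G[x]%g|)%N.
  have : (#[x]%g %| #|'C_G[x]%g|)%N by rewrite order_dvdG // inE Gx cent1id.
  apply: dvdn_trans; rewrite -order_dvdn om in x2 *.
  by case: m x2 {om} => [|[|m]] // _; rewrite !expnS mulnA dvdn_mulr.
split=> //; exact: dvdn_predn_or_succn.
Qed.

End SL2Torus.

(** * The neighbour of an odd number that is divisible by 4 *)

Definition mult4_neighbour n := if 4 %| n.-1 then n.-1 else n.+1.

(** For [n = 2k + 1] the neighbours are [2k] and [2(k + 1)]: the odd one of [k], [k + 1] is [M], and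
    twice the other is [N]. *)
Lemma mult4_neighbourP n (N := mult4_neighbour n) : odd n -> 1 < n ->
  [/\ 4 %| N, exists2 M, odd M & n.-1 * n.+1 = N * (2 * M) &
      forall c, c = n.-1 \/ c = n.+1 -> 4 %| c -> c = N].
Proof.
rewrite /N /mult4_neighbour => odd_n n_gt1.
have [k defn] : exists k, n = k.*2.+1.
  by exists n./2; rewrite -{1}(odd_double_half n) odd_n.
have [dvd4 | ndvd4] := boolP (4 %| n.-1).
  split=> //; last by move=> c [] ->; lia.
  by exists k.+1; [lia | rewrite defn; nia].
split; [lia | | by move=> c [] ->; lia].
by exists k; [lia | rewrite defn; nia].
Qed.

Lemma not_pow2_neighbour n : odd n -> 1 < n ->
  ~~ 2.-nat (mult4_neighbour n) <->
  ~ (exists k, n = (2 ^ k).-1 \/ n = 2 ^ k \/ n = (2 ^ k).+1).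
Proof.
rewrite /mult4_neighbour => odd_n n_gt1; split=> [npN [k] | npow].
  have k4 : 1 < k -> 4 %| 2 ^ k.
    by case: k => [|[|k]] // _; rewrite !expnS mulnA dvdn_mulr.
  have pk : 2.-nat (2 ^ k) by rewrite pnatX.
  have k_gt0 : 0 < 2 ^ k by rewrite expn_gt0.
  case: (ltnP 1 k) => [/k4 {}k4 | k_le1].
    case=> [defn | [defn | defn]]; move: npN.
    - have -> : (4 %| n.-1) = false by lia.
      have -> : n.+1 = 2 ^ k by lia.
      by rewrite pk.
    - by move=> _; lia.
    by rewrite defn /= k4 pk.
  (* For [k <= 1] the only odd value above 1 is [n = 3 = 2 + 1]; its neighbour divisible by 4 is 4,
     on the other side from 2. *)
  case: k k_le1 {k4 pk k_gt0} => [|[|//]] _; rewrite ?expn0 ?expn1 /=; first lia.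
  case=> [n1 | [n2 | n3]]; [lia | lia |].
  by move: npN; rewrite n3.
apply/negP; case: ifP => _ /p_natP[k defN]; apply: npow; exists k.
  by right; right; lia.
by left; lia.
Qed.

(** * Redundancy in SL(2, q), by the parities of [p] and [q] *)

Section SL2Redundancy.
Variable F : finFieldType.
Local Notation G := (SL2 F).
Local Notation q := #|F|.

(** Central elements have order dividing 2, so none but 1 is a [p]-element. *)
Lemma SL2_odd_not_redundant p : prime p -> p != 2 -> ~ has_redundant_Sylow p G.
Proof.
move=> pr_p p_neq2; apply: abelian_cent1_not_redundant; first exact: SL2_cent1_abelian.
move=> z Zz p_z; apply/eqP; rewrite -order_eq1; apply/eqP/(pnat_1 p_z).
apply: pnat_dvd (_ : p^'.-nat 2).
  by rewrite order_dvdn SL2_center_sqr1.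
by rewrite pnatE // !inE eq_sym.
Qed.

Lemma card_even_field : ~~ odd q -> (2 \in [pchar F])%R /\ exists k, q = 2 ^ k.
Proof.
have [p pr_p charFp] := finPcharP F; have := card_pprimeChar charFp => oq.
rewrite oq oddX negb_or => /andP[_ even_p].
have p2 : p = 2 by case: (even_prime pr_p) even_p => // ->.
by subst p; split=> //; exists (logn 2 q); rewrite oq pfactorK.
Qed.

(** In characteristic 2 the only square root of 1 is 1, so the centre is trivial. *)
Lemma SL2_even_not_redundant : ~~ odd q -> ~ has_redundant_Sylow 2 G.
Proof.
move=> /card_even_field[char2 _].
apply: abelian_cent1_not_redundant; first exact: SL2_cent1_abelian.
move=> z Zz _; have [Gz _] := setIP Zz.
have [a defz /eqP] := SL2_center_scalarP Gz Zz.
rewrite sqrf_eq1 oppr_pchar2 // orbb => /eqP a1.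
by apply: GLval_inj; rewrite defz a1.
Qed.

Lemma SL2_odd_redundant2 : odd q ->
  has_redundant_Sylow 2 G <-> ~~ 2.-nat (mult4_neighbour q).
Proof.
move=> odd_q; have q_gt1 := finNzRing_gt1 F; set N := mult4_neighbour q.
have [dvd4N [M odd_M defM] NE] := mult4_neighbourP odd_q q_gt1.
rewrite -/N in dvd4N defM NE.
have M_gt0 : 0 < M by case: M odd_M {defM}.
have N_gt0 : 0 < N.
  move: defM; rewrite lt0n; apply: contra_eqN => /eqP->.
  by rewrite mul0n -lt0n muln_gt0 -subn1 subn_gt0 q_gt1.
(* The order of [G] is [q * N * (2 * M)] with [q] and [M] odd. *)
have oG : (#|G|`_2 = 2 * N`_2)%N.
  have part_odd n : odd n -> (n`_2 = 1)%N.
    by move=> odd_n; apply: part_p'nat; rewrite p'natE // dvdn2 odd_n.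
  rewrite card_SL2 -mulnA defM !partnM ?muln_gt0 ?M_gt0 ?N_gt0 // 1?ltnW //.
  by rewrite (part_odd _ odd_q) (part_odd _ odd_M) mul1n muln1 mulnC part_pnat_id.
apply: cyclic_cent1_redundant_Sylow2 => //.
- exact: SL2_cent1_abelian.
- move=> z Zz p_z; apply/eqP; rewrite -order_eq1; apply/eqP; apply: pnat_1 p_z.
  by apply: (@pnat_dvd _ 2); rewrite ?order_dvdn ?SL2_center_sqr1.
- apply: leq_ltn_trans (card_SL2_center F) _; rewrite oG.
  have le4 : (4 <= N`_2)%N.
    by rewrite -[4](part_pnat_id (isT : 2.-nat 4)) dvdn_leq ?part_gt0 ?partn_dvd.
  by rewrite ltn_Pmulr // (leq_trans _ le4).
move=> x GZx p_x; have [cyc dvd4 oC] := SL2_noncentral_2elt_cent1 odd_q GZx p_x.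
by split=> //; apply: NE.
Qed.

Lemma SL2_redundant_Sylow p : prime p ->
  has_redundant_Sylow p G <->
  p = 2 /\ ~ (exists k, q = (2 ^ k).-1 \/ q = 2 ^ k \/ q = (2 ^ k).+1).
Proof.
move=> pr_p; have [-> {p pr_p} | p_neq2] := eqVneq p 2; last first.
  split=> [/SL2_odd_not_redundant[] // | [p2]]; by rewrite p2 in p_neq2.
have [odd_q | even_q] := boolP (odd q).
  rewrite SL2_odd_redundant2 // not_pow2_neighbour //; last exact: finNzRing_gt1.
  by split=> [|[]].
split=> [/(SL2_even_not_redundant even_q) // | [_ []]].
by have [_ [k qE]] := card_even_field even_q; exists k; right; left.
Qed.

End SL2Redundancy.

Theorem theoremD (p : nat) (F : finFieldType) (q : nat) :
  prime p -> #|F| = q ->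
  let crit := (p = 2 /\
       ~ (exists k : nat, q = (2 ^ k).-1 \/ q = 2 ^ k \/ q = (2 ^ k).+1)) in
  (has_redundant_Sylow p (SL2 F) <-> crit) /\
  (has_redundant_Sylow p (PSL2 F) <-> crit).
Proof.
move=> pr_p <- /=; split; first exact: SL2_redundant_Sylow.
by rewrite -SL2_redundant_Sylow //; apply: redundant_Sylow_central_quotient.
Qed.
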